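(* Let $\hat H$ be a Hermitian operator on a finite-dimensional complex Hilbert space, let $|\psi\rangle$ be a normalized state with energy variance $\mu_2>0$, let $\hat\rho=|\psi\rangle\langle\psi|$ and $\hat\chi=-[\hat H,[\hat H,\hat\rho]]$. Let $\mathcal S_H=\mathrm{span}\{|\psi\rangle,|v_H\rangle\}$ with $|v_H\rangle=\bar H|\psi\rangle/\sqrt{\mu_2}$, and let $\kappa=\mu_3/\mu_2^{3/2}$. Then the minimum of $\mathrm{Tr}[\hat\chi\,\hat{\mathcal O}]$ over all Hermitian (orthogonal) projectors $\hat{\mathcal O}$ acting on $\mathcal S_H$ (i.e. with range contained in $\mathcal S_H$) is $$\min_{\hat{\mathcal O}}\mathrm{Tr}[\hat\chi\,\hat{\mathcal O}]=-2\mu_2\sqrt{1+\tfrac14\kappa^2},$$ and it is attained uniquely at the rank-one projector $\hat\rho^{\mathrm A}=|\lambda_-\rangle\langle\lambda_-|$, where $|\lambda_-\rangle=\cos\phi\,|\psi\rangle+\sin\phi\,|v_H\rangle$ and $\phi\in(-\pi/4,\pi/4)$ is determined by $\tan(2\phi)=\kappa/2$. In particular, $$\mathrm{Tr}[\hat\chi\,\hat\rho^{\mathrm A}]\;\le\;-2\mu_2=\mathrm{Tr}[\hat\chi\,\hat\rho],$$ and this inequality is strict whenever $\kappa\neq0$.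
   Context: Here $\bar H=\hat H-\langle\psi|\hat H|\psi\rangle$ and $\mu_n=\langle\psi|\bar H^n|\psi\rangle$ is the $n$th central energy moment of $|\psi\rangle$; $\kappa$ is the skewness of the energy distribution. For a flow $\partial_\tau|\psi(\tau)\rangle=-[\hat H,\hat{\mathcal O}(\tau)]|\psi(\tau)\rangle$ the quantity $\mathrm{Tr}[\hat\chi(\tau)\hat{\mathcal O}(\tau)]$ is the instantaneous rate of change of the energy $\langle\psi(\tau)|\hat H|\psi(\tau)\rangle$; the choice $\hat{\mathcal O}=\hat\rho$ is standard normalized imaginary-time evolution and $\hat{\mathcal O}=\hat\rho^{\mathrm A}$ is augmented imaginary-time evolution. *)

(* Defs.v *)
From HB Require Import structures.
From mathcomp Require Import all_boot all_order all_algebra.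
From mathcomp Require Import spectral complex.
From mathcomp Require Import reals trigo.

Set Implicit Arguments.
Unset Strict Implicit.
Unset Printing Implicit Defensive.

Import Order.TTheory GRing.Theory Num.Theory.
Local Open Scope ring_scope.
Local Open Scope sesquilinear_scope.

(* Kets are column vectors in C^n with the standard inner product, bras their
   conjugate transposes, operators n x n matrices.  Scalars such as expectation
   values stay in C; for x y : C, x <= y means that y - x is real and
   nonnegative, so an inequality asserts realness of the difference. *)
Section States.
Variables (C : numClosedFieldType) (n : nat).
Implicit Types (A B H O : 'M[C]_n) (u v psi : 'cV[C]_n).

Definition braket u v : C := (u^t* *m v) 0 0.

Definition expval psi A : C := braket psi (A *m psi).

Definition normalized psi : Prop := braket psi psi = 1.

Definition ketbra psi : 'M[C]_n := psi *m psi^t*.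

Definition commutator A B : 'M[C]_n := A *m B - B *m A.

Definition chi H psi : 'M[C]_n :=
  - commutator H (commutator H (ketbra psi)).

Definition Hbar H psi : 'M[C]_n := H - (expval psi H)%:M.

Definition moment H psi (k : nat) : C := expval psi (Hbar H psi ^+ k).

(* sqrtC is the nonnegative root on nonnegative arguments, so for
   moment H psi 2 > 0 the denominator is mu_2 ^ (3/2). *)
Definition skewness H psi : C := moment H psi 3 / sqrtC (moment H psi 2) ^+ 3.

Definition v_H H psi : 'cV[C]_n :=
  (sqrtC (moment H psi 2))^-1 *: (Hbar H psi *m psi).

Definition S_H H psi : {vspace 'cV[C]_n} := <<[:: psi; v_H H psi]>>%VS.

Definition orth_projector O : Prop := O \is hermsymmx /\ O *m O = O.

Definition projector_on (S : {vspace 'cV[C]_n}) O : Prop :=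
  orth_projector O /\ forall u, O *m u \in S.

End States.

Section Augmented.
Variables (R : realType) (n : nat).

Definition lambda_minus (H : 'M[R[i]]_n) (psi : 'cV[R[i]]_n) (phi : R) :
    'cV[R[i]]_n :=
  (cos phi)%:C%C *: psi + (sin phi)%:C%C *: v_H H psi.

Definition rhoA (H : 'M[R[i]]_n) (psi : 'cV[R[i]]_n) (phi : R) : 'M[R[i]]_n :=
  ketbra (lambda_minus H psi phi).

(* The equation is in C, so it also asserts that the skewness is real. *)
Definition is_mixing_angle (H : 'M[R[i]]_n) (psi : 'cV[R[i]]_n) (phi : R) :
    Prop :=
  - (pi / 4) < phi < pi / 4 /\ (tan (2 * phi))%:C%C = skewness H psi / 2.

End Augmented.

(* Main.v *)
(** In the orthonormal basis (psi, v_H) the rate operator chi is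
    -2 mu2 [[1, kappa/2], [kappa/2, -1]]: a traceless real symmetric matrix,
    which the rotation by phi with tan (2 phi) = kappa/2 brings to
    diag(-E, E), E = 2 mu2 / cos (2 phi) = 2 mu2 sqrt(1 + kappa^2/4).
    A projector on S_H has diagonal entries a <= 1 and d >= 0 in the rotated
    basis, so its rate E (d - a) is at least -E, with equality only for the
    projector on the first basis vector. *)

Require Import Defs.
From HB Require Import structures.
From mathcomp Require Import all_boot all_order all_algebra.
From mathcomp Require Import spectral complex.
From mathcomp Require Import reals trigo.
From mathcomp Require Import ring lra.

Set Implicit Arguments.
Unset Strict Implicit.
Unset Printing Implicit Defensive.

Import Order.TTheory GRing.Theory Num.Theory.
Local Open Scope ring_scope.
Local Open Scope sesquilinear_scope.

(** * Bra-ket calculus and rank-one operators *)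

Section Braket.
Variables (C : numClosedFieldType) (n : nat).
Implicit Types (A B X O : 'M[C]_n) (u v l w x y : 'cV[C]_n) (a b : C).

Lemma trmxC_mul m p q (A : 'M[C]_(m, p)) (B : 'M[C]_(p, q)) :
  (A *m B)^t* = B^t* *m A^t*.
Proof. by rewrite trmx_mul map_mxM. Qed.

Lemma hermsymmx_trmxC A : A \is hermsymmx <-> A^t* = A.
Proof.
split; first by move/is_hermitianmxP => e; rewrite [RHS]e expr0 scale1r.
by move=> e; apply/is_hermitianmxP; rewrite expr0 scale1r e.
Qed.

Lemma trmxC_mul_braket u v : u^t* *m v = (braket u v)%:M.
Proof. by rewrite /braket -mx11_scalar. Qed.

Lemma braketDr u v w : braket u (v + w) = braket u v + braket u w.
Proof. by rewrite /braket mulmxDr mxE. Qed.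

Lemma braketZr u a v : braket u (a *: v) = a * braket u v.
Proof. by rewrite /braket -scalemxAr mxE. Qed.

Lemma braketC u v : (braket u v)^* = braket v u.
Proof.
have -> : braket v u = ((u^t* *m v)^t*) 0 0 by rewrite trmxC_mul trmxCK.
by rewrite /braket; move: (_ *m v) => M; rewrite !mxE.
Qed.

Lemma braketDl u v w : braket (v + w) u = braket v u + braket w u.
Proof. by rewrite -braketC braketDr rmorphD /= !braketC. Qed.

Lemma braketZl u a v : braket (a *: v) u = a^* * braket v u.
Proof. by rewrite -braketC braketZr rmorphM /= braketC. Qed.

Lemma braket_adj A u v : braket (A *m u) v = braket u (A^t* *m v).
Proof. by rewrite /braket trmxC_mul mulmxA. Qed.

Lemma braket_lincomb A a b a' b' u v :
  braket (a *: u + b *: v) (A *m (a' *: u + b' *: v)) =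
  a^* * a' * braket u (A *m u) + a^* * b' * braket u (A *m v)
  + (b^* * a' * braket v (A *m u) + b^* * b' * braket v (A *m v)).
Proof.
rewrite mulmxDr -!scalemxAr braketDr !braketZr !braketDl !braketZl; ring.
Qed.

Lemma braket_ge0 u : 0 <= braket u u.
Proof.
by rewrite /braket mxE sumr_ge0 // => k _; rewrite !mxE mulrC mul_conjC_ge0.
Qed.

Lemma ketbraM u v : ketbra u *m v = braket u v *: u.
Proof. by rewrite /ketbra -mulmxA trmxC_mul_braket mul_mx_scalar. Qed.

Lemma trmxC_ketbra u : (ketbra u)^t* = ketbra u.
Proof. by rewrite /ketbra trmxC_mul trmxCK. Qed.

Lemma mxtrace_outer A u v : \tr (A *m (u *m v^t*)) = braket v (A *m u).
Proof. by rewrite mulmxA mxtrace_mulC trmxC_mul_braket mxtrace_scalar. Qed.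

Lemma trmxC_ketbraD u v : (ketbra u + ketbra v)^t* = ketbra u + ketbra v.
Proof.
by rewrite -[in RHS](trmxC_ketbra u) -[in RHS](trmxC_ketbra v) -map_mxD -linearD.
Qed.

Lemma ketbra_sandwich A u v :
  ketbra u *m A *m ketbra v = braket u (A *m v) *: (u *m v^t*).
Proof.
rewrite /ketbra !mulmxA -(mulmxA u) -(mulmxA u) -[_ *m A *m v]mulmxA.
by rewrite trmxC_mul_braket mul_mx_scalar -scalemxAl.
Qed.

Lemma ketbra_normalized_projector u :
  normalized u -> orth_projector (ketbra u).
Proof.
move=> u1; split; first by apply/hermsymmx_trmxC; exact: trmxC_ketbra.
by rewrite {2}/ketbra mulmxA ketbraM u1 scale1r.
Qed.

(** A column times a row has rank at most one; rank zero would force [u = ketbra u *m u = 0],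
    contradicting the norm. *)
Lemma rank_ketbra u : normalized u -> \rank (ketbra u) = 1%N.
Proof.
move=> u1; apply/eqP.
rewrite eqn_leq (leq_trans (mxrankM_maxl _ _)) ?rank_leq_col //.
rewrite lt0n mxrank_eq0; apply/eqP => e0.
have := ketbraM u u; rewrite e0 mul0mx u1 scale1r => u0.
have := u1; rewrite /normalized -u0 /braket mulmx0 mxE => /esym/eqP.
by rewrite oner_eq0.
Qed.

(** * Orthonormal pairs, their rotations, and projectors on their span *)

Definition orthonormal2 u v :=
  [/\ braket u u = 1, braket v v = 1 & braket u v = 0].

(** Turns membership in a span into an equation: [ketbra u + ketbra v] is the orthogonal projector
    onto it. *)
Lemma memv_orthonormal2 u v x : orthonormal2 u v ->
  x \in <<[:: u; v]>>%VS -> (ketbra u + ketbra v) *m x = x.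
Proof.
case=> uu vv uv; rewrite span_cons span_seq1.
case/memv_addP=> y /vlineP[a ->] [z /vlineP[b ->] ->].
have vu : braket v u = 0 by rewrite -braketC uv rmorph0.
rewrite mulmxDl !ketbraM !braketDr !braketZr uu vv uv vu.
by rewrite !mulr0 !mulr1 addr0 add0r.
Qed.

Section Rotation.
Variables (c s : C).
Hypotheses (cR : c^* = c) (sR : s^* = s) (cs1 : c ^+ 2 + s ^+ 2 = 1).

Lemma orthonormal2_rot u v : orthonormal2 u v ->
  orthonormal2 (c *: u + s *: v) (- s *: u + c *: v).
Proof.
case=> uu vv uv; have vu : braket v u = 0 by rewrite -braketC uv rmorph0.
split; [rewrite -[RHS]cs1|rewrite -[RHS]cs1|];
  rewrite !(braketDl, braketDr, braketZl, braketZr) uu vv uv vu ?rmorphN /= cR sR; ring.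
Qed.

(** A real rotation keeps the span, hence its projector, so a range condition stated for the
    original pair carries over to the rotated one. *)
Lemma ketbra_rot u v :
  ketbra (c *: u + s *: v) + ketbra (- s *: u + c *: v) = ketbra u + ketbra v.
Proof.
apply/matrixP => i j; rewrite !mxE !big_ord1 !mxE !(rmorphD, rmorphM, rmorphN) /= cR sR.
rewrite -[RHS]mul1r -cs1; ring.
Qed.

End Rotation.

(* In the orthonormal basis (l, w) the operator X is diag(-E, E) and O has
   entries a, b, c, d; then tr(XO) = E (d - a) with a, d >= 0, and O^2 = O
   forces a = a^2 + |c|^2, hence a <= 1. *)
Lemma projector_trace_min X O l w (E : C) : 0 < E -> orthonormal2 l w ->
  braket l (X *m l) = - E -> braket w (X *m w) = E ->
  braket l (X *m w) = 0 -> braket w (X *m l) = 0 ->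
  orth_projector O -> (ketbra l + ketbra w) *m O = O ->
  - E <= \tr (X *m O) /\ (\tr (X *m O) = - E -> O = ketbra l).
Proof.
move=> E0 [ll ww lw] Xll Xww Xlw Xwl [/hermsymmx_trmxC OH OO] PO.
have OP : O *m (ketbra l + ketbra w) = O.
  by rewrite -[RHS]OH -[in RHS]PO trmxC_mul OH trmxC_ketbraD.
set a := braket l (O *m l); set b := braket l (O *m w).
set c := braket w (O *m l); set d := braket w (O *m w).
(* With [P = ketbra l + ketbra w], expand [O = P O P] into its four matrix units. *)
have OE : O = a *: ketbra l + b *: (l *m w^t*) +
              (c *: (w *m l^t*) + d *: ketbra w).
  rewrite -[LHS]OP -{1}PO mulmxDr !mulmxDl !ketbra_sandwich -/a -/b -/c -/d.
  by rewrite /ketbra addrACA.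
have Oexp x : braket x (O *m x) = braket (O *m x) (O *m x).
  by rewrite braket_adj OH mulmxA OO.
have a0 : 0 <= a by rewrite /a Oexp braket_ge0.
have d0 : 0 <= d by rewrite /d Oexp braket_ge0.
have aE : a = a ^+ 2 + c^* * c.
  have -> : a ^+ 2 = a^* * a by rewrite geC0_conj // expr2.
  rewrite {1}/a Oexp.
  have {2}-> : O *m l = a *: l + c *: w.
    by rewrite -[in LHS]PO -mulmxA mulmxDl !ketbraM.
  by rewrite braketDr !braketZr -(braketC l) -(braketC w) -/a -/c mulrC [c * _]mulrC.
have bE : b = c^* by rewrite /b /c braketC braket_adj OH.
(* Here a (1 - a) = |c|^2 is nonnegative; divide by [a] unless it is zero. *)
have a1 : 0 <= 1 - a.
  have: 0 <= a * (1 - a).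
    have -> : a * (1 - a) = c^* * c by rewrite mulrBr mulr1 {1}aE expr2; ring.
    by rewrite mulrC mul_conjC_ge0.
  have [->|an0] := eqVneq a 0; first by rewrite subr0 ler01.
  by rewrite pmulr_rge0 // lt_def an0.
have tE : \tr (X *m O) = - E + E * ((1 - a) + d).
  rewrite {1}OE !mulmxDr -!scalemxAr !mxtraceD !mxtraceZ /ketbra !mxtrace_outer.
  by rewrite Xll Xww Xlw Xwl; ring.
rewrite tE; split.
  by rewrite lerDl; apply: mulr_ge0; [exact: ltW | exact: addr_ge0].
(* At equality both nonnegative terms 1 - a and d vanish; then a = a^2 + |c|^2 with a = 1 kills the
   off-diagonal entries. *)
move=> e; have: E * ((1 - a) + d) == 0 by rewrite -(inj_eq (addrI (- E))) e addr0.
rewrite mulf_eq0 gt_eqF //= paddr_eq0 // subr_eq0 => /andP[/eqP a_1 /eqP d_0].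
have c_0 : c = 0.
  move: aE; rewrite -a_1 expr1n => /eqP.
  rewrite -subr_eq0 opprD addrA subrr add0r oppr_eq0 mulf_eq0 conjC_eq0 orbb.
  by move/eqP.
by rewrite OE bE c_0 rmorph0 d_0 -a_1 scale1r !scale0r !addr0.
Qed.

(** With r the ket-bra of [u], -[A,[A,r]] = 2 A r A - A A r - r A A. The rank-one r splits each term
    into two brackets, and hermiticity moves [A] across them. *)
Lemma braket_double_commutator A u x y : A^t* = A ->
  braket x (- commutator A (commutator A (ketbra u)) *m y) =
  2 * (braket x (A *m u) * braket (A *m u) y)
  - braket x (A *m (A *m u)) * braket u y
  - braket x u * braket (A *m (A *m u)) y.
Proof.
move=> AH; have:= ketbraM u; move: (ketbra u) => r rM.
rewrite /commutator !mulmxBr !mulmxBl mulNmx !mulmxBl -!mulmxA !rM -!scalemxAr.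
rewrite -!scaleN1r !(braketDr, braketZr) !braket_adj AH; ring.
Qed.

End Braket.

(** * Entries of the rate operator in the basis [psi], [v_H] *)

Section Rate.
Variables (C : numClosedFieldType) (n : nat) (H : 'M[C]_n) (psi : 'cV[C]_n).
Hypotheses (Hherm : H \is hermsymmx) (psi1 : normalized psi)
  (mu2_gt0 : 0 < moment H psi 2).

Let K := Hbar H psi.
Let v := v_H H psi.
Let mu2 := moment H psi 2.
Let kappa := skewness H psi.
Let m := sqrtC mu2.

Let HH : H^t* = H. Proof. exact/hermsymmx_trmxC. Qed.

Lemma trmxC_Hbar : K^t* = K.
Proof.
rewrite /K /Hbar linearB /= tr_scalar_mx map_mxB map_scalar_mx HH /=.
by rewrite /expval braketC braket_adj HH.
Qed.

Let KH x y : braket (K *m x) y = braket x (K *m y).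
Proof. by rewrite braket_adj trmxC_Hbar. Qed.

Lemma braket_Hbar : braket psi (K *m psi) = 0.
Proof.
rewrite /K /Hbar mulmxBl mul_scalar_mx -scaleN1r scalerA braketDr braketZr psi1.
by rewrite mulN1r mulr1 subrr.
Qed.

(** Scalar matrices commute with everything, so centering [H] leaves [chi] unchanged and its entries
    become central moments. *)
Lemma commutator_Hbar X : commutator H X = commutator K X.
Proof.
rewrite /commutator /K /Hbar mulmxBl mulmxBr scalar_mxC.
by rewrite opprB addrA subrK.
Qed.

Lemma braket_chi x y : braket x (chi H psi *m y) =
  2 * (braket x (K *m psi) * braket (K *m psi) y)
  - braket x (K *m (K *m psi)) * braket psi y
  - braket x psi * braket (K *m (K *m psi)) y.
Proof.
by rewrite /chi !commutator_Hbar (braket_double_commutator _ _ _ trmxC_Hbar).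
Qed.

Let m_gt0 : 0 < m. Proof. by rewrite sqrtC_gt0. Qed.

Let m2 : m ^+ 2 = mu2. Proof. exact: sqrtCK. Qed.

Let Kpsi : K *m psi = m *: v.
Proof. by rewrite /v /v_H scalerA mulfV ?scale1r // gt_eqF. Qed.

Let mC : m^* = m. Proof. by rewrite geC0_conj // ltW. Qed.

Lemma moment2_norm : mu2 = braket (K *m psi) (K *m psi).
Proof. by rewrite KH /mu2 /moment /expval expr2 mulmxA. Qed.

Lemma moment3_braket : moment H psi 3 = braket (K *m psi) (K *m (K *m psi)).
Proof. by rewrite KH /moment /expval exprSr expr2 !mulmxA. Qed.

(** Orthogonality is the vanishing first central moment; the norm is one because [mu2] is the
    squared norm of [K *m psi]. *)
Lemma orthonormal2_v_H : orthonormal2 psi v.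
Proof.
split=> //; last first.
  by rewrite /v /v_H braketZr braket_Hbar mulr0.
apply: (mulfI (lt0r_neq0 mu2_gt0)); rewrite mulr1 -/mu2 {2}moment2_norm Kpsi.
by rewrite braketZl braketZr mC -m2 expr2 mulrA.
Qed.

Lemma skewness_moment3 : moment H psi 3 = kappa * m * mu2.
Proof.
by rewrite /kappa /skewness -/mu2 -/m -mulrA -m2 -exprS divfK // expf_neq0 // gt_eqF.
Qed.

Lemma skewness_real : kappa^* = kappa.
Proof.
have m3 : (moment H psi 3)^* = moment H psi 3.
  by rewrite moment3_braket braketC KH.
by rewrite /kappa /skewness fmorph_div rmorphXn /= -/mu2 -/m mC m3.
Qed.

Let KKpsi_v : braket v (K *m (K *m psi)) = kappa * mu2.
Proof.
(* Multiplying by [m] replaces [v] by [K *m psi], which makes the left side the third moment. *)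
apply: (mulfI (lt0r_neq0 m_gt0)); rewrite -{1}mC -braketZl -Kpsi.
by rewrite -moment3_braket skewness_moment3; ring.
Qed.

Let KKpsi_psi : braket psi (K *m (K *m psi)) = mu2.
Proof. by rewrite -KH -moment2_norm. Qed.

Let KKC y : braket (K *m (K *m psi)) y = (braket y (K *m (K *m psi)))^*.
Proof. by rewrite braketC. Qed.

Let mu2C : mu2^* = mu2. Proof. by rewrite geC0_conj // ltW. Qed.

(** Since [K *m psi = m *: v], the only further data needed are the components of [K *m (K *m psi)]
    along [psi] and [v], namely [mu2] and [kappa * mu2]. *)
Lemma chi_entries :
  [/\ braket psi (chi H psi *m psi) = - (2 * mu2),
      braket v (chi H psi *m v) = 2 * mu2,
      braket psi (chi H psi *m v) = - (kappa * mu2) &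
      braket v (chi H psi *m psi) = - (kappa * mu2)].
Proof.
have [_ vv pv] := orthonormal2_v_H.
have vp : braket v psi = 0 by rewrite -braketC pv rmorph0.
have e1 : braket psi psi = 1 by [].
have kC : (kappa * mu2)^* = kappa * mu2 by rewrite rmorphM /= skewness_real mu2C.
have mvl x : braket (m *: v) x = m * braket v x by rewrite braketZl mC.
have mvr x : braket x (m *: v) = m * braket x v by rewrite braketZr.
split; rewrite braket_chi !KKC ?KKpsi_v ?KKpsi_psi ?kC ?mu2C Kpsi !mvl !mvr
  ?vv ?pv ?vp ?e1 -?m2; ring.
Qed.

(** * Diagonalization of the rate operator by a rotation *)

Section Angle.
Variables c s : C.
(** Here [c] and [s] stand for the cosine and sine of phi, so c^2 - s^2 is cos(2 phi), and [kappaD]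
    is tan(2 phi) = kappa/2 cleared of denominators. *)
Hypotheses (cR : c^* = c) (sR : s^* = s) (cs1 : c ^+ 2 + s ^+ 2 = 1)
  (D_gt0 : 0 < c ^+ 2 - s ^+ 2)
  (kappaD : kappa * (c ^+ 2 - s ^+ 2) = 4 * c * s).

Let D := c ^+ 2 - s ^+ 2.
Let l := c *: psi + s *: v.
Let w := - s *: psi + c *: v.

Let D_neq0 : D != 0. Proof. by rewrite gt_eqF. Qed.

(** This is 1 + tan^2 = 1/cos^2 at 2 phi, obtained from D^2 + 4 c^2 s^2 = (c^2 + s^2)^2; positivity
    of [D] selects the root. *)
Lemma sqrtC_mixing : sqrtC (1 + kappa ^+ 2 / 4) = D^-1.
Proof.
have -> : 1 + kappa ^+ 2 / 4 = D^-1 ^+ 2.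
  have D2 : D ^+ 2 != 0 by rewrite expf_neq0.
  apply: (mulfI D2); rewrite exprVn mulfV //.
  have -> : D ^+ 2 * (1 + kappa ^+ 2 / 4) = D ^+ 2 + (kappa * D) ^+ 2 / 4 by ring.
  rewrite kappaD; transitivity ((c ^+ 2 + s ^+ 2) ^+ 2); last by rewrite cs1 expr1n.
  by rewrite /D; field.
by rewrite sqrCK // invr_ge0 ltW.
Qed.

Lemma chi_diag :
  [/\ braket l (chi H psi *m l) = - (2 * mu2 / D),
      braket w (chi H psi *m w) = 2 * mu2 / D,
      braket l (chi H psi *m w) = 0 &
      braket w (chi H psi *m l) = 0].
Proof.
have [epp evv epv evp] := chi_entries.
have DE : D^-1 = D + kappa * c * s.
  apply: (mulfI D_neq0); rewrite mulfV //.
  have -> : D * (D + kappa * c * s) = D ^+ 2 + (kappa * D) * c * s by ring.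
  rewrite kappaD; transitivity ((c ^+ 2 + s ^+ 2) ^+ 2); first by rewrite cs1 expr1n.
  rewrite /D; ring.
(* This product is exactly the off-diagonal entry in the rotated basis. *)
have off : mu2 * (4 * c * s - kappa * D) = 0 by rewrite kappaD subrr mulr0.
split; [rewrite DE|rewrite DE|rewrite -[RHS]off|rewrite -[RHS]off];
  rewrite /l /w braket_lincomb ?rmorphN /= cR sR epp evv epv evp /D; ring.
Qed.

Lemma augmented_optimal (O : 'M[C]_n) : projector_on (S_H H psi) O ->
  let min_rate := - (2 * mu2 * sqrtC (1 + kappa ^+ 2 / 4)) in
  min_rate <= \tr (chi H psi *m O) /\
  (\tr (chi H psi *m O) = min_rate -> O = ketbra l).
Proof.
case=> Oproj Orange /=; rewrite sqrtC_mixing.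
have [Xll Xww Xlw Xwl] := chi_diag.
apply: (projector_trace_min _ (orthonormal2_rot cR sR cs1 orthonormal2_v_H) Xll Xww)=> //.
  by rewrite divr_gt0 // mulr_gt0.
(* The projector onto [S_H] fixes [O] column by column: each column is [O] applied to a basis
   vector, hence lies in [S_H]. *)
rewrite ketbra_rot //; apply/trmx_inj/row_matrixP => i.
rewrite -!tr_col; congr trmx; rewrite !colE -mulmxA.
exact: (memv_orthonormal2 orthonormal2_v_H (Orange _)).
Qed.

Lemma normalized_rot : normalized l.
Proof. by have [] := orthonormal2_rot cR sR cs1 orthonormal2_v_H. Qed.

Lemma projector_on_rot : projector_on (S_H H psi) (ketbra l).
Proof.
split=> [|u]; first exact/ketbra_normalized_projector/normalized_rot.
rewrite ketbraM; apply/memvZ/memvD; apply/memvZ/memv_span;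
  by rewrite !inE eqxx ?orbT.
Qed.

Lemma rate_rot :
  \tr (chi H psi *m ketbra l) = - (2 * mu2 * sqrtC (1 + kappa ^+ 2 / 4)).
Proof.
by have [e _ _ _] := chi_diag; rewrite /ketbra mxtrace_outer e sqrtC_mixing.
Qed.

End Angle.

Lemma rate_standard : \tr (chi H psi *m ketbra psi) = - (2 * mu2).
Proof. by have [e _ _ _] := chi_entries; rewrite /ketbra mxtrace_outer. Qed.

(** A square in [C] need not be nonnegative; realness of the skewness makes this one |kappa|^2. *)
Let kappa2_ge0 : 0 <= kappa ^+ 2.
Proof. by rewrite expr2 -{2}skewness_real mul_conjC_ge0. Qed.

Lemma min_rate_le : - (2 * mu2 * sqrtC (1 + kappa ^+ 2 / 4)) <= - (2 * mu2).
Proof.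
rewrite lerN2 -[leLHS]mulr1 ler_pM2l ?mulr_gt0 // -[leLHS]sqrtC1.
by rewrite ler_sqrtC ?lerDl ?nnegrE ?addr_ge0 ?divr_ge0.
Qed.

Lemma min_rate_lt : kappa != 0 ->
  - (2 * mu2 * sqrtC (1 + kappa ^+ 2 / 4)) < - (2 * mu2).
Proof.
move=> k0; rewrite ltrN2 -[ltLHS]mulr1 ltr_pM2l ?mulr_gt0 // -[ltLHS]sqrtC1.
rewrite ltr_sqrtC ?ltrDl ?nnegrE ?addr_ge0 ?divr_ge0 //.
by rewrite divr_gt0 // lt_def kappa2_ge0 expf_neq0.
Qed.

End Rate.

(** * Existence, uniqueness and trigonometry of the mixing angle *)

Section MixingAngle.
Variables (R : realType) (n : nat) (H : 'M[R[i]]_n) (psi : 'cV[R[i]]_n).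
Hypotheses (Hherm : H \is hermsymmx) (mu2_gt0 : 0 < moment H psi 2).

(** The skewness is real, and doubling sends the allowed range of phi to the open interval from
    -pi/2 to pi/2, on which [atan] inverts [tan]. *)
Lemma is_mixing_angleE :
  exists2 k : R, skewness H psi = k%:C%C &
    forall phi, is_mixing_angle H psi phi <-> phi = atan (k / 2) / 2.
Proof.
have /complex_realP[k kE] : skewness H psi \is Num.real.
  by apply/CrealP; exact: skewness_real.
exists k => // phi; rewrite /is_mixing_angle kE.
have -> : k%:C%C / 2 = (k / 2)%:C%C by rewrite rmorphM fmorphV rmorph_nat.
have rangeE x : (- (pi / 4) < x < pi / 4) = (2 * x \in `]- (pi / 2), (pi / 2)[%R).
  by rewrite in_itv /=; congr (_ && _); apply/idP/idP => ?; lra.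
split=> [[]|->].
  by rewrite rangeE => /tanK tE /complexI e; rewrite -e tE; lra.
have e : 2 * (atan (k / 2) / 2) = atan (k / 2) by lra.
rewrite rangeE in_itv /= !e atanK; split=> //.
by rewrite atan_gtNpi2 atan_ltpi2.
Qed.

(** Supplies what the rotation argument asks of [c] and [s], by the double-angle formulas; the range
    of phi gives cos(2 phi) > 0. *)
Lemma mixing_angle_coefficients phi : is_mixing_angle H psi phi ->
  let c := (cos phi)%:C%C in let s := (sin phi)%:C%C in
  [/\ c^* = c, s^* = s, c ^+ 2 + s ^+ 2 = 1, 0 < c ^+ 2 - s ^+ 2 &
      skewness H psi * (c ^+ 2 - s ^+ 2) = 4 * c * s].
Proof.
move=> [range tanE] /=.
have cos2E : cos (2 * phi) = cos phi ^+ 2 - sin phi ^+ 2.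
  by rewrite mulr_natl mulr2n cosD -!expr2.
have sin2E : sin (2 * phi) = 2 * cos phi * sin phi.
  by rewrite mulr_natl mulr2n sinD; ring.
have cos2_gt0 : 0 < cos (2 * phi) by apply: cos_gt0_pihalf; lra.
split.
- by apply/CrealP/complex_realP; exists (cos phi).
- by apply/CrealP/complex_realP; exists (sin phi).
- by rewrite -!rmorphXn -rmorphD /= cos2Dsin2.
- by rewrite -!rmorphXn -rmorphB /= -cos2E ltcR.
- have -> : skewness H psi = (2 * tan (2 * phi))%:C%C.
    by rewrite rmorphM rmorph_nat /= tanE; field.
  have tanM : tan (2 * phi) * cos (2 * phi) = sin (2 * phi).
    by rewrite /tan divfK ?gt_eqF.
  rewrite -!rmorphXn -rmorphB -rmorphM /= -cos2E -[2 * _ * _]mulrA tanM sin2E.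
  by rewrite !rmorphM rmorph_nat /=; ring.
Qed.

End MixingAngle.

Theorem mainTheorem2 (R : realType) (n : nat)
    (H : 'M[R[i]]_n) (psi : 'cV[R[i]]_n) :
  H \is hermsymmx ->
  normalized psi ->
  0 < moment H psi 2 ->
  let mu2 := moment H psi 2 in
  let kappa := skewness H psi in
  let min_rate := - (2 * mu2 * sqrtC (1 + kappa ^+ 2 / 4)) in
  (exists! phi : R, is_mixing_angle H psi phi) /\
  forall phi : R, is_mixing_angle H psi phi ->
  let rho := ketbra psi in
  let rhoA := rhoA H psi phi in
  [/\ projector_on (S_H H psi) rhoA /\ \rank rhoA = 1%N,
      \tr (chi H psi *m rhoA) = min_rate,
      (forall O : 'M[R[i]]_n, projector_on (S_H H psi) O ->
         min_rate <= \tr (chi H psi *m O) /\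
         (\tr (chi H psi *m O) = min_rate -> O = rhoA)),
      \tr (chi H psi *m rhoA) <= - (2 * mu2) /\
        \tr (chi H psi *m rho) = - (2 * mu2) &
      kappa != 0 -> \tr (chi H psi *m rhoA) < - (2 * mu2)].
Proof.
move=> Hherm psi1 mu2_gt0 mu2 kappa min_rate; split.
  have [k _ angleE] := is_mixing_angleE Hherm mu2_gt0.
  exists (atan (k / 2) / 2); split; first exact/angleE.
  by move=> phi /angleE ->.
move=> phi phiA rho rhoA; have /= [cR sR cs1 D_gt0 kappaD] := mixing_angle_coefficients phiA.
have rateA : \tr (chi H psi *m rhoA) = min_rate.
  exact: (rate_rot Hherm psi1 mu2_gt0 cR sR cs1 D_gt0 kappaD).
split=> //.
- split; first exact: (projector_on_rot Hherm psi1 mu2_gt0 cR sR cs1).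
  exact: (rank_ketbra (normalized_rot Hherm psi1 mu2_gt0 cR sR cs1)).
- move=> O; exact: (augmented_optimal Hherm psi1 mu2_gt0 cR sR cs1 D_gt0 kappaD).
- by rewrite rateA; split; [exact: min_rate_le | exact: rate_standard].
- by move=> kappa_neq0; rewrite rateA; exact: min_rate_lt.
Qed.
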